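(* Let $\mathcal{H}=\{H_1,\dots,H_m\}$ be a toric hyperplane arrangement on $T^n$ with intersection poset $\mathcal{P}$ and toric characteristic polynomial $\chi(\mathcal{H};t)=\sum_{x\in\mathcal{P},\,x\neq\emptyset}\mu(\hat0,x)\,t^{\dim x}$. Then $$\chi(\mathcal{H};t)=v\Big(T^n-\bigcup_{i=1}^m H_i\Big),$$ where $v$ is the valuation on $L$ with values in $\mathbb{Z}[t]$ which, on each element of $G$ written as a disjoint union $\bigcup_{p=1}^r(U+x_p)$ of $r$ pairwise disjoint translates of a $k$-dimensional toric subspace $U$, takes the value $r\,t^k$.
   Context: $T^n=\mathbb{R}^n/\mathbb{Z}^n$ (an abelian group). A toric subspace is the image under $\mathbb{R}^n\to\mathbb{R}^n/\mathbb{Z}^n$ of an affine subspace $\{A\vec v=\vec b\}$ with $A$ rational and $\vec b$ real; its dimension is that of the affine subspace. Translates: $U+x=\{u+x:u\in U\}$. A finite intersection of toric subspaces is a disjoint union of finitely many translates of a single toric subspace. $G$ is the collection of all finite intersections of toric subspaces, and $L$ is the distributive lattice of subsets of $T^n$ generated from $G$ by finite intersections, unions and complements; a valuation on $L$ is a function with $v(\emptyset)=0$ and $v(A)+v(B)=v(A\cap B)+v(A\cup B)$. A toric hyperplane is a toric subspace which is the image of an affine hyperplane $\{\vec a\cdot\vec x=b\}$ with $\vec a\neq 0$ rational; a toric hyperplane arrangement is a finite collection of toric hyperplanes. Its intersection poset $\mathcal{P}$ consists of all connected components of all intersections $\bigcap_{i\in S}H_i$, $S\subseteq\{1,\dots,m\}$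 (the empty intersection being $T^n$), together with the empty set, ordered by reverse inclusion; $T^n$ is its minimum $\hat0$, $\emptyset$ its maximum, and $\mu$ is its Möbius function. *)

(* Defs.v *)
From HB Require Import structures.
From mathcomp Require Import all_boot all_order all_algebra.
From mathcomp Require Import finmap.
From mathcomp Require Import all_classical all_reals all_analysis.

Set Implicit Arguments.
Unset Strict Implicit.
Unset Printing Implicit Defensive.

Import Order.TTheory GRing.Theory Num.Theory.
Import numFieldNormedType.Exports.

Local Open Scope classical_set_scope.
Local Open Scope ring_scope.

Section Mobius.
Variables (d : Order.disp_t) (X : porderType d) (P : {fset X}).
Implicit Types x y z : X.

Fixpoint mobius_rec (k : nat) x y : int :=
  if x == y then 1 else
  if k is k'.+1 then
    if (x < y)%O then - \sum_(z <- P | (x <= z < y)%O) mobius_rec k' x z else 0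
  else 0.

(* The Mobius function of the subposet [P], only meaningful on elements of [P].
   The interval [x, y[ shrinks at each recursive call, so #|P| steps suffice:
   the defining recurrence is [mobiusxx] and [mobius_sum] below. *)
Definition mobius x y : int := mobius_rec #|` P| x y.

Lemma mobius_rec_stable k k' x y :
  (count (fun z => x <= z < y)%O P <= k)%N ->
  (count (fun z => x <= z < y)%O P <= k')%N ->
  x \in P -> mobius_rec k x y = mobius_rec k' x y.
Proof.
move=> + + xP; elim: k k' y => [|k IH] [|k'] y lek lek' //=; case: eqP => // _.
- case: ifPn => // xy; move: lek; rewrite leqn0 -/(0 < _)%N => /eqP c0.
  suff : (0 < count (fun z => x <= z < y)%O P)%N by rewrite c0.
  by rewrite -has_count; apply/hasP; exists x; rewrite ?lexx.
- case: ifPn => // xy; move: lek'; rewrite leqn0 => /eqP c0.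
  suff : (0 < count (fun z => x <= z < y)%O P)%N by rewrite c0.
  by rewrite -has_count; apply/hasP; exists x; rewrite ?lexx.
- case: ifPn => // xy; congr (- _); rewrite [LHS]big_seq_cond [RHS]big_seq_cond.
  apply: eq_bigr => z /andP[zP /andP[xz zy]].
  have lt : (count (fun w => x <= w < z)%O P < count (fun w => x <= w < y)%O P)%N.
    have -> : count (fun w => x <= w < y)%O P =
        (count (fun w => x <= w < z)%O P +
         count (fun w => (x <= w < y) && ~~ (x <= w < z))%O P)%N.
      rewrite -count_predUI [X in (_ + X)%N](_ : _ = 0%N) ?addn0.
        apply: eq_count => w /=.
        case: (boolP (x <= w)%O) => //= xw.
        by case: (boolP (w < z)%O) => /= [/lt_trans/(_ zy) ->|_]; rewrite ?andbT.
      by apply/eqP; rewrite -leqn0 leqNgt -has_count; apply/hasPn => w _ /=;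
         case: (x <= w < z)%O; rewrite ?andbF.
    rewrite -[ltnLHS]addn0 ltn_add2l -has_count.
    by apply/hasP; exists z => //=; rewrite xz zy ltxx.
  by apply: IH; rewrite -ltnS; apply: leq_trans lt _.
Qed.

Lemma mobiusxx x : mobius x x = 1.
Proof. by rewrite /mobius; case: #|` P| => [|k] /=; rewrite eqxx. Qed.

Lemma mobius_recE x y : x \in P -> (x < y)%O ->
  mobius x y = - \sum_(z <- P | (x <= z < y)%O) mobius x z.
Proof.
move=> xP xy; rewrite /mobius.
rewrite (@mobius_rec_stable _ (#|` P|).+1) ?count_size //=; last first.
  exact/leqW/count_size.
by rewrite lt_eqF // xy.
Qed.

Lemma mobius_sum x y : x \in P -> y \in P -> (x < y)%O ->
  \sum_(z <- P | (x <= z <= y)%O) mobius x z = 0.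
Proof.
move=> xP yP xy.
rewrite big_mkcond (bigD1_seq y) ?fset_uniq //= lexx (ltW xy) /=.
rewrite mobius_recE //; apply/eqP; rewrite addrC subr_eq0; apply/eqP.
rewrite -big_mkcondr; apply: eq_bigl => z.
by rewrite lt_neqAle andbCA.
Qed.

End Mobius.

Section Torus.
Variables (R : realType) (n : nat).

Definition integer_lattice : {pred 'rV[R]_n} := mxOver Num.int.

Fact integer_lattice_zmod_closed : zmod_closed integer_lattice.
Proof.
split=> [|u w /mxOverP uZ /mxOverP wZ]; first exact/mxOver0/rpred0.
by apply/mxOverP => i j; rewrite !mxE rpredB.
Qed.

HB.instance Definition _ := GRing.isZmodClosed.Build 'rV[R]_n integer_lattice
  integer_lattice_zmod_closed.

Definition torus : Type := quotient_topology (Quotient.quot integer_lattice).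

HB.instance Definition _ := Topological.on torus.
HB.instance Definition _ :=
  GRing.Zmodule.copy torus (Quotient.quot integer_lattice).

Definition torus_pi : 'rV[R]_n -> torus := (\pi_(torus))%qT.

(* Vectors are rows, so the system "A v = b" is written [v *m A = b]. *)
Definition affine_subspace m (A : 'M[rat]_(n, m)) (b : 'rV[R]_m) :
    set 'rV[R]_n :=
  [set v | v *m map_mx ratr A = b].

(* [kermx] is a matrix whose rows span the direction {v | v A = 0} of the
   (nonempty) affine subspace; its rank is the dimension of that space. *)
Definition toric_subspace (k : nat) (U : set torus) : Prop :=
  exists m (A : 'M[rat]_(n, m)) (b : 'rV[R]_m),
    [/\ affine_subspace A b !=set0,
        \rank (kermx (map_mx ratr A : 'M[R]_(n, m))) = k
      & U = torus_pi @` affine_subspace A b].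

Definition toric_dim (U : set torus) : nat :=
  xget 0%N [set k | toric_subspace k U].

Definition translate (U : set torus) (x : torus) : set torus :=
  [set u + x | u in U].

Definition toric_intersections : set (set torus) :=
  finI_from [set U | exists k, toric_subspace k U] id.

Definition toric_lattice : set (set torus) :=
  smallest [set L | [/\ setI_closed L, setU_closed L & setC_closed L]]
    toric_intersections.

(* A valuation on [toric_lattice] is represented by a function on all subsets
   of the torus, its values outside the lattice being irrelevant. *)
Definition valuation_on_lattice (v : set torus -> {poly int}) : Prop :=
  v set0 = 0 /\
  forall A B, toric_lattice A -> toric_lattice B ->
    v A + v B = v (A `&` B) + v (A `|` B).

Definition toric_valuation (v : set torus -> {poly int}) : Prop :=
  valuation_on_lattice v /\
  forall (r k : nat) (U : set torus) (x : 'I_r -> torus),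
    toric_subspace k U ->
    trivIset setT (fun p => translate U (x p)) ->
    toric_intersections (\bigcup_p translate U (x p)) ->
    v (\bigcup_p translate U (x p)) = r%:R * 'X^k.

Definition toric_hyperplane (H : set torus) : Prop :=
  exists (a : 'rV[rat]_n) (b : R),
    a != 0 /\
    H = torus_pi @` [set x : 'rV[R]_n | \sum_i ratr (a 0 i) * x 0 i = b].

Definition intersection_sets m (H : 'I_m -> set torus) : set (set torus) :=
  [set C | exists (S : set 'I_m) (x : torus),
     (\bigcap_(i in S) H i) x /\
     C = connected_component (\bigcap_(i in S) H i) x] `|` [set set0].

(* [(set torus)^d] carries the reverse inclusion order. [fset_set] is the
   identity on finite sets and returns [fset0] on infinite ones; the set of
   these components is finite. *)
Definition intersection_poset m (H : 'I_m -> set torus) :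
    {fset (set torus)^d} :=
  fset_set (intersection_sets H : set (set torus)^d).

Definition toric_char_poly m (H : 'I_m -> set torus) : {poly int} :=
  \sum_(x <- intersection_poset H | x != set0)
    mobius (intersection_poset H) (setT : set torus) x *: 'X^(toric_dim x).

End Torus.

(* Main.v *)
(* Modulo Z^n, an intersection X of toric hyperplanes is cut out by integral
   linear forms, whose values on X differ by integers.  Hence the level sets of
   these forms are relatively open in X: they are its connected components, they
   are toric subspaces, and there are finitely many of them.
   A point p lies in exactly those elements C of the intersection poset that are
   below the smallest one containing p, so the Mobius recursion says that the sum
   of mu(0, C) over the C containing p is the indicator of the complement of the
   hyperplanes.  A valuation respects linear relations between indicators. *)
Require Import Defs.
From mathcomp Require Import all_boot all_order all_algebra.
From mathcomp Require Import finmap.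
From mathcomp Require Import all_classical all_reals all_analysis.

Set Implicit Arguments.
Unset Strict Implicit.
Unset Printing Implicit Defensive.

Import Order.TTheory GRing.Theory Num.Theory.
Import numFieldNormedType.Exports.

Local Open Scope classical_set_scope.
Local Open Scope ring_scope.

(** * The quotient map onto the torus, and connectedness of affine images *)

Section TorusProjection.
Variables (R : realType) (n : nat).
Implicit Types x y z : 'rV[R]_n.

Lemma torus_piP x y :
  reflect (torus_pi x = torus_pi y) (x - y \in @integer_lattice R n).
Proof.
rewrite (@Quotient.idealrBE _ (@integer_lattice R n)).
exact: (iffP eqP).
Qed.

Lemma torus_pi_surj (p : torus R n) : exists x, torus_pi x = p.
Proof. by exists (repr p); exact: reprK. Qed.

Lemma torus_pi_continuous : continuous (@torus_pi R n).
Proof. exact: pi_continuous. Qed.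

Lemma torus_pi_open (E : set 'rV[R]_n) : open E -> open (@torus_pi R n @` E).
Proof.
move=> oE.
have cT z : continuous (fun x : 'rV[R]_n => x + z).
  move=> x.
  exact: (@cvgD R 'rV[R]_n 'rV[R]_n (nbhs x) _ id (cst z) x z
    cvg_id (cvg_cst _)).
rewrite /open /= /quotient_open.
(* The preimage of the image of [E] is the union of the integer translates of [E]. *)
rewrite (_ : _ @^-1` _ = \bigcup_(z in [set z | z \in @integer_lattice R n])
  ((fun x => x + z) @^-1` E)).
  by apply: bigcup_open => z _; apply: open_comp => // x _; exact: cT.
apply/seteqP; split=> [x [y Ey /torus_piP yx]|x [z zZ Exz]].
  by exists (y - x) => //=; rewrite addrC subrK.
by exists (x + z) => //; apply/torus_piP; rewrite addrAC subrr add0r.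
Qed.

Lemma mulmxr_continuous m (A : 'M[R]_(n, m)) (j : 'I_m) :
  continuous (fun x : 'rV[R]_n => (x *m A) 0 j).
Proof.
rewrite (_ : (fun _ => _) = (fun x => \sum_i x 0 i * A i j)); last first.
  by apply/funext => x; rewrite mxE.
apply: continuous_big.
  exact: add_continuous.
move=> i _ x.
apply: (@continuousM R _ (fun x : 'rV[R]_n => x 0 i) (cst (A i j))).
  exact: coord_continuous.
exact: cst_continuous.
Qed.

(** The affine subspace is a union of lines through one point [x0], and each line has a connected
    image. *)
Lemma affine_connected m (A : 'M[rat]_(n, m)) (b : 'rV[R]_m) :
  affine_subspace A b !=set0 ->
  connected (@torus_pi R n @` affine_subspace A b).
Proof.
move=> [x0 Ax0].
pose seg x := (fun t : R => torus_pi (x0 + t *: (x - x0))) @` setT.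
rewrite (_ : _ @` _ = \bigcup_(x in affine_subspace A b) seg x); last first.
  apply/seteqP; split=> [p [x Ax <-]|p [x Ax [t _ <-]]].
    by exists x => //; exists 1; rewrite // scale1r addrC subrK.
  exists (x0 + t *: (x - x0)) => //.
  rewrite /affine_subspace /= in Ax Ax0 *.
  by rewrite mulmxDl -scalemxAl mulmxBl Ax Ax0 subrr scaler0 addr0.
apply: bigcup_connected.
  by exists (torus_pi x0) => x _; exists 0; rewrite // scale0r addr0.
move=> x _; apply: connected_continuous_connected.
  by apply/connected_intervalP.
have cseg : continuous (fun t : R => x0 + t *: (x - x0)).
  move=> t.
  apply: (@continuousD R 'rV[R]_n R (cst x0) (fun t => t *: (x - x0))).
    exact: cst_continuous.
  exact: scalel_continuous.
apply: continuous_subspaceT => t.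
exact: (@continuous_comp _ _ _ _ _ t (cseg t) (@torus_pi_continuous _)).
Qed.

Lemma torus_setT_affine :
  [set: torus R n] = @torus_pi R n @` affine_subspace (0 : 'M[rat]_(n, 0)) 0.
Proof.
apply/seteqP; split=> // p _; have [x <-] := torus_pi_surj p.
by exists x => //; apply/rowP => -[].
Qed.

Lemma torus_connected : connected [set: torus R n].
Proof.
rewrite torus_setT_affine; apply: affine_connected.
by exists 0; apply/rowP => -[].
Qed.

End TorusProjection.

(** * Connected components as level sets of integral forms *)

Section ComponentsOfIntegralSections.
Variables (R : realType) (n m : nat).
Implicit Types (A : 'M[rat]_(n, m)) (X : set (torus R n)) (x y : 'rV[R]_n).

(* Intersections of toric hyperplanes have this shape, the columns of [A] being
   integral normal vectors. *)
Definition integral_section A X : Prop :=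
  (forall x y, X (torus_pi x) -> x *m map_mx ratr A = y *m map_mx ratr A ->
     X (torus_pi y)) /\
  (forall x y, X (torus_pi x) -> X (torus_pi y) ->
     (y - x) *m map_mx ratr A \is a mxOver Num.int).

Definition torus_fiber A x : set (torus R n) :=
  @torus_pi R n @` affine_subspace A (x *m map_mx ratr A).

(** The radius 1 separates fibres inside an integral section, where values of the forms differ by
    integers. *)
Definition fiber_nbhs A x : set (torus R n) :=
  @torus_pi R n @` [set y | forall j, `|((y - x) *m map_mx ratr A) 0 j| < 1].

Lemma torus_fiber_refl A x : torus_fiber A x (torus_pi x).
Proof. by exists x. Qed.

Lemma torus_fiber_sub_nbhs A x : torus_fiber A x `<=` fiber_nbhs A x.
Proof.
move=> _ [y yx <-]; exists y => //= j.
by rewrite mulmxBl yx subrr mxE normr0 ltr01.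
Qed.

Lemma torus_fiber_sub A X x : integral_section A X -> X (torus_pi x) ->
  torus_fiber A x `<=` X.
Proof. by move=> [hX _] Xx _ [y yx <-]; exact: hX Xx _. Qed.

Lemma fiber_nbhs_open A x : open (fiber_nbhs A x).
Proof.
apply: torus_pi_open; rewrite openE => y /= hy.
apply: (@filter_forall _ _
  (fun j => [set z | `|((z - x) *m map_mx ratr A) 0 j| < 1]) (nbhs y)) => j.
have e_gt0 : 0 < 1 - `|((y - x) *m map_mx ratr A) 0 j| by rewrite subr_gt0.
have := @mulmxr_continuous R n m (map_mx ratr A) j y _ (nbhsx_ballx _ _ e_gt0).
apply: (@filterS _ (nbhs y)) => z /=.
rewrite -ball_normE /= ltrBrDr distrC => h; apply: le_lt_trans h.
apply: le_trans (ler_normD _ _).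
by rewrite !mulmxBl !mxE addrA subrK.
Qed.

(** An integer of absolute value less than 1 is zero. *)
Lemma fiber_nbhsI A X x : integral_section A X -> X (torus_pi x) ->
  X `&` fiber_nbhs A x `<=` torus_fiber A x.
Proof.
move=> [_ hX] Xx p [Xp [y yx yp]]; exists y => //.
apply/eqP; rewrite -subr_eq0 -mulmxBl; apply/eqP/rowP => j.
rewrite [RHS]mxE; apply/eqP; apply: contraTT (yx j) => nz.
rewrite -{}yp in Xp; have /mxOverP/(_ 0 j) yxZ := hX _ _ Xx Xp.
by rewrite -leNgt norm_intr_ge1.
Qed.

(** Two lifts of the common point differ by a lattice vector; moving [y] by that vector gives it the
    value of [x]. So fibres that meet coincide. *)
Lemma torus_fiber_meet A x y p : torus_fiber A x p -> torus_fiber A y p ->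
  torus_fiber A x (torus_pi y).
Proof.
move=> [w wx <-] [u uy /torus_piP uw].
exists (y + (w - u)).
  rewrite /affine_subspace /= in uy wx *.
  by rewrite mulmxDl mulmxBl uy wx addrC subrK.
by apply/torus_piP; rewrite addrAC subrr add0r -opprB rpredN.
Qed.

(* Fibres are relatively open in [X], hence also relatively closed. *)
Lemma connected_component_fiber A X x : integral_section A X ->
  X (torus_pi x) -> connected_component X (torus_pi x) = torus_fiber A x.
Proof.
move=> hX Xx; apply/seteqP; split; last first.
  apply: connected_component_max; first exact: torus_fiber_refl.
    exact: torus_fiber_sub Xx.
  by apply: affine_connected; exists x.
set K := connected_component _ _.
have KX : K `<=` X by exact: connected_component_sub.
have Kx : K (torus_pi x) by exact: connected_component_refl.
(* [K] is connected, so its part in [fiber_nbhs A x], nonempty and both open and closed in [K], is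
   all of [K]. *)
suff KE : K `&` fiber_nbhs A x = K.
  move=> p Kp; apply: (fiber_nbhsI hX Xx); split; first exact: KX.
  by move: Kp; rewrite -KE => -[].
apply: (@component_connected _ X (torus_pi x)).
- exists (torus_pi x); split=> //.
  exact/torus_fiber_sub_nbhs/torus_fiber_refl.
- by exists (fiber_nbhs A x) => //; exact: fiber_nbhs_open.
(* Closedness: on [K], avoiding the neighbourhoods of all other fibres amounts to lying in the fibre
   of [x]. *)
pose D := [set y | X (torus_pi y) /\ ~ torus_fiber A x (torus_pi y)].
exists (~` \bigcup_(y in D) fiber_nbhs A y).
  by apply/open_closedC/bigcup_open => y _; exact: fiber_nbhs_open.
apply/seteqP; split=> p [Kp].
  move=> px; split=> // -[y [Xy nxy] py]; apply: nxy.
  apply: (@torus_fiber_meet _ _ _ p); apply: (fiber_nbhsI hX) => //;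
    by split=> //; exact: KX.
have [y yp] := torus_pi_surj p; rewrite -yp in Kp *.
move=> nD; split=> //; apply: torus_fiber_sub_nbhs; apply: contrapT => nxy.
apply: nD; exists y; first by split=> //; exact: KX.
exact/torus_fiber_sub_nbhs/torus_fiber_refl.
Qed.

End ComponentsOfIntegralSections.

(** * Common denominators and finiteness of the set of components *)

Lemma rat_mx_denominator (R : archiRealFieldType) (m n : nat)
    (B : 'M[rat]_(m, n)) :
  exists D : nat, D.+1%:R *: map_mx ratr B \is a @mxOver m n R Num.int.
Proof.
(* The product of all denominators is a common one; being positive, it has the form [D.+1]. *)
pose d := (\prod_i \prod_j `|denq (B i j)|)%N.
have d_gt0 : (0 < d)%N.
  by apply: prodn_gt0 => i; apply: prodn_gt0 => j; rewrite absz_gt0 denq_neq0.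
exists d.-1; rewrite prednK //; apply/mxOverP => i j; rewrite !mxE.
have [k ->] : exists k, d = (k * `|denq (B i j)|)%N.
  exists (d %/ `|denq (B i j)|)%N; rewrite divnK //.
  by rewrite /d (bigD1 i) //= (bigD1 j) //= -mulnA dvdn_mulr.
have den0 : (denq (B i j))%:~R != 0 :> R by rewrite intr_eq0 denq_neq0.
rewrite natrM pmulrn -[X in _ * X * _]/((Posz `|denq (B i j)|)%:~R).
rewrite absz_denq -mulrA [X in _ * X]mulrC divfK //.
by rewrite rpredM // ?natr_int // intr_int.
Qed.

Section FiniteComponents.
Variables (R : realType) (n m : nat).
Implicit Types (A : 'M[rat]_(n, m)) (X : set (torus R n)) (x y : 'rV[R]_n).

(* If [D B] is integral for a partial inverse [B] of [A], every fibre in [X]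
   meets [x0 + (1/D) Z^n], which has finitely many points modulo [Z^n]. *)
Lemma finite_components A X : integral_section A X ->
  finite_set [set connected_component X p | p in X].
Proof.
move=> hX.
have [[p0 Xp0]|/set0P/negP/negPn/eqP->] := pselect (X !=set0); last first.
  by rewrite image_set0; exact: finite_set0.
have [x0 x0p] := torus_pi_surj p0; rewrite -{}x0p in Xp0.
pose B : 'M[R]_(m, n) := map_mx ratr (pinvmx A).
have [D DB] := rat_mx_denominator R (pinvmx A).
have D0 : D.+1%:R != 0 :> R by rewrite pnatr_eq0.
(* These points represent [x0 + (1/(D+1)) Z^n] modulo [Z^n]. *)
pose rep (f : {ffun 'I_n -> 'I_D.+1}) : 'rV[R]_n :=
  x0 + \row_i ((f i)%:R / D.+1%:R).
apply: (@sub_finite_set _ _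
  [set connected_component X (torus_pi (rep f)) | f in setT]); last first.
  exact/finite_image/finite_finset.
move=> _ [p Xp <-]; have [x xp] := torus_pi_surj p; rewrite -{}xp in Xp *.
have wZ := hX.2 _ _ Xp0 Xp; set w := _ *m _ in wZ.
pose u := D.+1%:R *: (w *m B).
have uZ : u \is a mxOver Num.int by rewrite /u scalemxAr mxOverM.
pose c i := Num.floor (u 0 i).
have uE i : u 0 i = (c i)%:~R by rewrite floorK //; move/mxOverP: uZ.
(* Reducing the numerators [c i] modulo [D.+1] moves [x0 + w *m B] by a lattice vector. *)
pose f : {ffun 'I_n -> 'I_D.+1} := [ffun i => inord `|(c i %% D.+1%:Z)%Z|%N].
exists f => //; apply/esym/same_connected_component.
rewrite (connected_component_fiber hX) //.
(* Since [w] lies in the row space of [A], the partial inverse gives [w B A = w], so this point has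
   the same value as [x]. *)
exists (x0 + w *m B).
  rewrite /affine_subspace /= mulmxDl /w /B map_pinvmx mulmxKpV ?submxMl //.
  by rewrite mulmxBl addrC subrK.
apply/torus_piP; rewrite opprD addrACA subrr add0r.
apply/mxOverP => i j.
have wBE : (w *m B) 0 j = (c j)%:~R / D.+1%:R.
  by apply: (mulfI D0); rewrite mulrCA divff // mulr1 -uE [RHS]mxE.
move: (w *m B) wBE => wB wBE; rewrite ord1 !mxE wBE -mulrBl ffunE.
have f_lt : (`|(c j %% D.+1%:Z)%Z| < D.+1)%N.
  by rewrite -ltz_nat gez0_abs ?modz_ge0 // ltz_pmod.
rewrite inordK // pmulrn gez0_abs ?modz_ge0 // {1}(divz_eq (c j) D.+1%:Z).
by rewrite rmorphD rmorphM /= addrK -pmulrn mulfK.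
Qed.

End FiniteComponents.

(** * Toric hyperplanes and their intersections *)

Section ToricHyperplanes.
Variables (R : realType) (n : nat).
Implicit Types (a : 'cV[rat]_n) (x y z : 'rV[R]_n) (X : set (torus R n)).

(** Multiplying the equation by a common denominator of the normal vector makes the form
    integer-valued on the lattice. *)
Lemma toric_hyperplane_integral X : toric_hyperplane X ->
  exists a (b : 'rV[R]_1), [/\ a != 0,
    map_mx ratr a \is a @mxOver n 1 R Num.int &
    X = @torus_pi R n @` affine_subspace a b].
Proof.
move=> [a [b [a0 ->]]]; have [D Da] := rat_mx_denominator R a.
have D0 : D.+1%:R != 0 :> R by rewrite pnatr_eq0.
have mapE :
    map_mx ratr (D.+1%:R *: a^T) = D.+1%:R *: (map_mx ratr a)^T :> 'cV[R]_n.
  by apply/matrixP => i j; rewrite !mxE rmorphM /= ratr_nat.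
exists (D.+1%:R *: a^T), (const_mx (D.+1%:R * b)); split.
- by rewrite scaler_eq0 pnatr_eq0 /= trmx_eq0.
- apply/mxOverP => i j; rewrite mapE !mxE.
  by have /mxOverP/(_ j i) := Da; rewrite !mxE.
- congr (_ @` _); apply/seteqP; split=> x;
    rewrite /affine_subspace /= mapE -scalemxAr.
    move=> xb; apply/rowP => i; rewrite !mxE -xb; congr (_ * _).
    by apply: eq_bigr => j _; rewrite !mxE ord1 mulrC.
  move=> /rowP/(_ 0); rewrite !mxE => /(mulfI D0) <-.
  by apply: eq_bigr => j _; rewrite !mxE mulrC.
Qed.

Lemma affine_image_mem m (A : 'M[rat]_(n, m)) (b : 'rV[R]_m) x :
  (@torus_pi R n @` affine_subspace A b) (torus_pi x) <->
  exists2 z, z \is a mxOver Num.int & (x + z) *m map_mx ratr A = b.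
Proof.
split=> [[y yb /torus_piP yx]|[z zZ xz]].
  by exists (y - x) => //; rewrite addrC subrK.
by exists (x + z) => //; apply/torus_piP; rewrite addrAC subrr add0r.
Qed.

(** Integer vectors move both lifts into the affine subspace, and an integral [A] sends these
    vectors to integers. *)
Lemma integral_section_affine m (A : 'M[rat]_(n, m)) (b : 'rV[R]_m) :
  map_mx ratr A \is a @mxOver n m R Num.int ->
  integral_section A (@torus_pi R n @` affine_subspace A b).
Proof.
move=> AZ; split=> x y.
  move=> /affine_image_mem[z zZ xz] xy; apply/affine_image_mem; exists z => //.
  by rewrite mulmxDl -xy -mulmxDl.
move=> /affine_image_mem[z zZ xz] /affine_image_mem[w wZ yw].
have -> : (y - x) *m map_mx ratr A = (z - w) *m map_mx ratr A.
  apply/eqP; rewrite -subr_eq0 -mulmxBl opprB addrACA -opprD.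
  by rewrite mulmxBl xz yw subrr.
by rewrite mxOverM // rpredB.
Qed.

Lemma affine_image_toric m (A : 'M[rat]_(n, m)) (b : 'rV[R]_m) :
  affine_subspace A b !=set0 ->
  exists k, toric_subspace k (@torus_pi R n @` affine_subspace A b).
Proof.
by move=> Ab; exists (\rank (kermx (map_mx ratr A : 'M[R]_(n, m)))), m, A, b.
Qed.

Lemma col_neq0_surj a : a != 0 ->
  forall b : 'rV[R]_1, exists x, x *m map_mx ratr a = b.
Proof.
move=> a0 b; have ra : \rank a = 1%N.
  by apply/eqP; rewrite eqn_leq rank_leq_col lt0n mxrank_eq0.
exists (b *m pinvmx (map_mx ratr a)); rewrite mulmxKpV //.
by apply: submx_full; rewrite /row_full mxrank_map ra.
Qed.

Lemma toric_hyperplane_subspace X :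
  toric_hyperplane X -> exists k, toric_subspace k X.
Proof.
move=> /toric_hyperplane_integral[a [b [a0 _ ->]]]; apply: affine_image_toric.
exact: col_neq0_surj.
Qed.

Lemma toric_hyperplane_proper X : toric_hyperplane X -> exists p, ~ X p.
Proof.
move=> /toric_hyperplane_integral[a [b [a0 aZ ->]]].
have [_ hX] := integral_section_affine b aZ.
(* The form takes the values 0 at the origin and 1/2 at [x]; were both points on the hyperplane,
   these would differ by an integer. *)
have [x xa] := col_neq0_surj a0 (const_mx 2^-1).
apply: contrapT => /forallNP/= nX.
have /mxOverP/(_ 0 0) := hX 0 x (contrapT (nX _)) (contrapT (nX _)).
rewrite subr0 xa mxE => /norm_intr_ge1.
rewrite invr_eq0 pnatr_eq0 => /(_ isT); rewrite ger0_norm ?invr_ge0 //.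
by rewrite leNgt invf_lt1 ?ltr1n.
Qed.

Lemma integral_section_bigcap m (H : 'I_m -> set (torus R n)) (S : set 'I_m) :
  (forall i, toric_hyperplane (H i)) ->
  exists A : 'M[rat]_(n, m), integral_section A (\bigcap_(i in S) H i).
Proof.
move=> /(fun h i => toric_hyperplane_integral (h i))/fin_all_exists[a].
move=> /fin_all_exists[b hab].
(* Columns outside [S] are zeroed, so the number of columns does not depend on [S]. *)
pose A := \matrix_(i, j) (if `[< S j >] then a j i 0 else 0).
have AE x j : (x *m map_mx ratr A) 0 j =
    if `[< S j >] then (x *m map_mx ratr (a j)) 0 0 else 0.
  rewrite !mxE; case: ifPn => Sj.
    by apply: eq_bigr => i _; rewrite !mxE Sj.
  by apply: big1 => i _; rewrite !mxE (negbTE Sj) rmorph0 mulr0.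
have hsec j : integral_section (a j) (H j).
  by have [_ aZ ->] := hab j; exact: integral_section_affine.
exists A; split=> x y.
  move=> Xx xy j Sj; apply: (hsec j).1 (Xx _ Sj) _; apply/rowP => i.
  by have /rowP/(_ j) := xy; rewrite !AE asboolT // ord1.
move=> Xx Xy; apply/mxOverP => i j; rewrite ord1 AE; case: asboolP => // Sj.
by have /mxOverP := (hsec j).2 _ _ (Xx _ Sj) (Xy _ Sj).
Qed.

Variables (m : nat) (H : 'I_m -> set (torus R n)).
Hypothesis hH : forall i, toric_hyperplane (H i).

Lemma intersection_sets_finite : finite_set (intersection_sets H).
Proof.
rewrite finite_setU; split; last exact: finite_set1.
(* Indexing by the finite type [{set 'I_m}] leaves finitely many intersections, each with finitely
   many components. *)
apply: (@sub_finite_set _ _ (\bigcup_(S in [set: {set 'I_m}])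
  [set connected_component (\bigcap_(i in [set` S]) H i) p |
   p in \bigcap_(i in [set` S]) H i])).
  move=> _ [S [p [Sp ->]]]; exists [set i | `[< S i >]]%SET => //=.
  have -> : [set` [set i | `[< S i >]]%SET] = S.
    by apply/seteqP; split=> i /=; rewrite inE => /asboolP.
  by exists p.
apply: bigcup_finite; first exact: finite_finset.
move=> S _; have [A /finite_components] := integral_section_bigcap [set` S] hH.
exact.
Qed.

Lemma intersection_sets_toric C : intersection_sets H C -> C !=set0 ->
  exists k, toric_subspace k C.
Proof.
case=> [[S [p [Sp ->]]] _|-> [] //]; have [x xp] := torus_pi_surj p.
rewrite -{}xp in Sp *; have [A hA] := integral_section_bigcap S hH.
rewrite (connected_component_fiber hA Sp).
by apply: affine_image_toric; exists x.
Qed.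

End ToricHyperplanes.

(** * Valuations and linear relations between indicators *)

Section Valuation.
Variables (R : realType) (n : nat).
Implicit Types (A B E : set (torus R n)) (v : set (torus R n) -> {poly int}).

Lemma toric_latticeI A B :
  toric_lattice A -> toric_lattice B -> toric_lattice (A `&` B).
Proof.
by move=> LA LB L hL; have [[LI _ _] _] := hL; apply: LI; [exact: LA|exact: LB].
Qed.

Lemma toric_latticeU A B :
  toric_lattice A -> toric_lattice B -> toric_lattice (A `|` B).
Proof.
by move=> LA LB L hL; have [[_ LU _] _] := hL; apply: LU; [exact: LA|exact: LB].
Qed.

Lemma toric_latticeC A : toric_lattice A -> toric_lattice (~` A).
Proof. by move=> LA L hL; have [[_ _ LC] _] := hL; apply: LC; exact: LA. Qed.

Lemma toric_subspace_intersections k A :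
  toric_subspace k A -> toric_intersections A.
Proof. by move=> Ak; apply: finI_from1; exists k. Qed.

Lemma toric_subspace_lattice k A : toric_subspace k A -> toric_lattice A.
Proof.
by move=> Ak L [_ GL]; apply: GL; exact: toric_subspace_intersections Ak.
Qed.

Lemma toric_latticeT : toric_lattice [set: torus R n].
Proof.
have [k] : exists k, toric_subspace k [set: torus R n].
  rewrite torus_setT_affine; apply: affine_image_toric.
  by exists 0; apply/rowP => -[].
exact: toric_subspace_lattice.
Qed.

Lemma toric_lattice_bigcup m (H : 'I_m -> set (torus R n)) :
  (forall i, toric_lattice (H i)) -> toric_lattice (\bigcup_i H i).
Proof.
move=> LH; rewrite (_ : setT = [set` enum 'I_m]); last first.
  by apply/seteqP; split=> i //= _; rewrite mem_enum.
rewrite bigcup_seq.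
apply: big_ind => [|A B|i _] //; last exact: toric_latticeU.
by rewrite -setCT; apply: toric_latticeC; exact: toric_latticeT.
Qed.

Lemma valuation_split v A B : valuation_on_lattice v ->
  toric_lattice A -> toric_lattice B -> v A = v (A `&` B) + v (A `&` ~` B).
Proof.
move=> [v0 vD] LA LB; rewrite vD; last 2 first.
- exact: toric_latticeI.
- by apply: toric_latticeI => //; exact: toric_latticeC.
by rewrite setIACA setICr setI0 v0 add0r -setIUr setUCr setIT.
Qed.

(** Induction on [s], with [E] and [c0] varying: cut [E] along the first set [A i]. The remaining
    coefficients sum to [c0 - c i] on the inner part and to [c0] on the outer part. *)
Lemma valuation_sum_indicators v (I : eqType) (s : seq I) (c : I -> int)
    (A : I -> set (torus R n)) (E : set (torus R n)) (c0 : int) :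
  valuation_on_lattice v -> (forall i, i \in s -> toric_lattice (A i)) ->
  toric_lattice E ->
  (forall p, E p -> \sum_(i <- s | `[< A i p >]) c i = c0) ->
  \sum_(i <- s) c i *: v (E `&` A i) = c0 *: v E.
Proof.
move=> hv; elim: s E c0 => [|i s IH] E c0 LA LE.
  rewrite big_nil => Ec0.
  (* A point of [E] forces [c0 = 0]; if there is none, [v E] vanishes. *)
  have [[p Ep]|/set0P/negP/negPn/eqP->] := pselect (E !=set0).
    by rewrite -(Ec0 p Ep) big_nil scale0r.
  by rewrite hv.1 scaler0.
have LAi : toric_lattice (A i) by apply: LA; rewrite mem_head.
have LAs j : j \in s -> toric_lattice (A j).
  by move=> js; apply: LA; rewrite inE js orbT.
move=> Ec0; rewrite big_cons.
rewrite (eq_big_seq (fun j => c j *: v (E `&` A i `&` A j) +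
    c j *: v (E `&` ~` A i `&` A j))); last first.
  move=> j js; rewrite (@valuation_split _ (E `&` A j) (A i)) ?scalerDr //.
    by rewrite setIAC [in X in _ + X]setIAC.
  exact: toric_latticeI (LAs j js).
rewrite big_split /= (IH (E `&` A i) (c0 - c i)) ?(IH (E `&` ~` A i) c0) //.
- rewrite scalerBl [in RHS](valuation_split hv LE LAi) scalerDr.
  by rewrite addrA addrCA subrr addr0.
- by apply: toric_latticeI => //; exact: toric_latticeC.
- move=> p [Ep nAp]; rewrite -(Ec0 p Ep) big_cons.
  by case: asboolP.
- exact: toric_latticeI.
- move=> p [Ep Ap]; rewrite -(Ec0 p Ep) big_cons asboolT //.
  by rewrite addrC addKr.
Qed.

Lemma toric_valuation_subspace v k A :
  toric_valuation v -> toric_subspace k A -> v A = 'X^k.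
Proof.
(* The case [r = 1], with the trivial translate. *)
move=> [_ hv] Ak; have AE : \bigcup_(p in [set: 'I_1]) translate A 0 = A.
  rewrite bigcup_const; last by exists 0.
  apply/seteqP; split=> [_ [u Au <-]|u Au]; first by rewrite addr0.
  by exists u; rewrite ?addr0.
have := hv 1%N k A (fun=> 0) Ak; rewrite AE mul1r; apply.
  by move=> i j _ _ _; rewrite !ord1.
exact: toric_subspace_intersections Ak.
Qed.

(* Dimensions can be read off the valuation, so they are unique. *)
Lemma toric_dimE v k A :
  toric_valuation v -> toric_subspace k A -> toric_dim A = k.
Proof.
move=> hv Ak; have exk : exists k, toric_subspace k A by exists k.
have := toric_valuation_subspace hv (xgetPex 0%N exk).
rewrite (toric_valuation_subspace hv Ak).
move=> /(congr1 (fun q : {poly int} => size q)).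
by rewrite !size_polyXn => -[].
Qed.

End Valuation.

(** * The Möbius function of the intersection poset *)

Lemma dual_set_leP (X : Type) (A B : (set X)^d) :
  reflect ((B : set X) `<=` A) (A <= B)%O.
Proof. exact: (@subsetPset X B A). Qed.

Section Arrangement.
Variables (R : realType) (n m : nat) (H : 'I_m -> set (torus R n)).
Hypothesis hH : forall i, toric_hyperplane (H i).
Local Notation P := (intersection_poset H).
Local Notation T := (setT : (set (torus R n))^d).

Lemma mem_intersection_poset (C : (set (torus R n))^d) :
  reflect (intersection_sets H C) (C \in P).
Proof.
rewrite in_fset_set; last exact: intersection_sets_finite.
by apply: (iffP idP); rewrite inE.
Qed.

(** The smallest poset element containing [p]: all the hyperplanes through [p] are intersected. *)
Definition flat_at (p : torus R n) : set (torus R n) :=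
  connected_component (\bigcap_(i in [set i | H i p]) H i) p.

Lemma flat_at_refl p : flat_at p p.
Proof. exact: connected_component_refl. Qed.

Lemma flat_at_poset p : (flat_at p : (set (torus R n))^d) \in P.
Proof.
by apply/mem_intersection_poset; left; exists [set i | H i p], p; split.
Qed.

(** If [p] lies in a component of the intersection over [S], every hyperplane indexed by [S] passes
    through [p]; so [flat_at p] is a connected subset of that intersection. *)
Lemma flat_at_min p C : intersection_sets H C -> C p -> flat_at p `<=` C.
Proof.
case=> [[S [q [Sq ->]]] Cp|-> //].
rewrite (same_connected_component Cp); apply: connected_component_max.
- exact: flat_at_refl.
- move=> x /connected_component_sub hx i Si; apply: hx => /=.
  exact: (connected_component_sub Cp).
- exact: component_connected.
Qed.

Lemma flat_at_setT p : (flat_at p = setT) <-> ~ (\bigcup_i H i) p.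
Proof.
split=> [fT [i _ Hip]|nH].
  have [q nq] := toric_hyperplane_proper (hH i); apply: nq.
  have : flat_at p q by rewrite fT.
  by move=> /connected_component_sub; exact.
rewrite /flat_at (_ : [set i | H i p] = set0).
  by rewrite bigcap_set0 connected_component_id //; exact: torus_connected.
by apply/seteqP; split=> // i Hip; apply: nH; exists i.
Qed.

Lemma setT_poset : T \in P.
Proof.
apply/mem_intersection_poset; left; exists set0, 0; split=> //.
by rewrite bigcap_set0 connected_component_id //; exact: torus_connected.
Qed.

(* The poset elements containing [p] form the interval below [flat_at p]. *)
Lemma mobius_sum_at p :
  \sum_(C <- P | `[< (C : set (torus R n)) p >]) mobius P T C =
  (~~ `[< (\bigcup_i H i) p >])%:R.
Proof.
have -> : \sum_(C <- P | `[< (C : set (torus R n)) p >]) mobius P T C =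
    \sum_(C <- P | (T <= C <= (flat_at p : (set (torus R n))^d))%O) mobius P T C.
  rewrite big_seq_cond [RHS]big_seq_cond; apply: eq_bigl => C.
  apply: andb_id2l => /mem_intersection_poset CP; apply/asboolP/andP.
    move=> Cp; split; first exact/dual_set_leP.
    by apply/dual_set_leP; exact: flat_at_min.
  by move=> [_ /dual_set_leP]; apply; exact: flat_at_refl.
case: asboolP => [Hp|/flat_at_setT ->] /=.
  (* On a hyperplane, [flat_at p] is strictly above the minimum, so the sum over the closed interval
     vanishes. *)
  apply: mobius_sum; [exact: setT_poset|exact: flat_at_poset|].
  rewrite lt_neqAle; apply/andP; split; last exact/dual_set_leP.
  by apply/eqP => /esym/flat_at_setT; exact.
(* Off the hyperplanes the interval is reduced to the minimum. *)
rewrite (eq_bigl (pred1 T)); last by move=> C; rewrite /= eq_le andbC.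
rewrite -big_filter filter_pred1_uniq ?fset_uniq //; last exact: setT_poset.
by rewrite (big_seq1 _ T) mobiusxx.
Qed.

End Arrangement.

Theorem theorem1p16 (R : realType) (n m : nat) (H : 'I_m -> set (torus R n))
    (v : set (torus R n) -> {poly int})
    (hH : forall i, toric_hyperplane (H i))
    (hv : toric_valuation v) :
  toric_char_poly H = v (~` \bigcup_i H i).
Proof.
have LH : toric_lattice (\bigcup_i H i).
  apply: toric_lattice_bigcup => i.
  by have [k /toric_subspace_lattice] := toric_hyperplane_subspace (hH i).
set U := \bigcup_i H i in LH *.
pose mu := mobius (intersection_poset H) (setT : set (torus R n)).
have LP C : C \in intersection_poset H -> toric_lattice C.
  move=> /(mem_intersection_poset hH) CP.
  have [C0|/set0P/negP/negPn/eqP->] := pselect (C !=set0).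
    by have [k /toric_subspace_lattice] := intersection_sets_toric hH CP C0.
  by rewrite -setCT; apply: toric_latticeC; exact: toric_latticeT.
have [hvL _] := hv.
(* The empty set can be put back into the sum because [v set0 = 0]. *)
transitivity (\sum_(C <- intersection_poset H) mu C *: v C).
  rewrite [LHS]big_mkcond big_seq [RHS]big_seq; apply: eq_bigr => C.
  move=> /(mem_intersection_poset hH) CP.
  case: eqVneq => [->|/set0P C0]; first by rewrite hvL.1 scaler0.
  have [k Ck] := intersection_sets_toric hH CP C0.
  by rewrite (toric_dimE hv Ck) (toric_valuation_subspace hv Ck).
rewrite (eq_big_seq (fun C => mu C *: v (U `&` C) + mu C *: v (~` U `&` C))).
  rewrite big_split /= (valuation_sum_indicators (c0 := 0) hvL LP LH).
    rewrite scale0r add0r (valuation_sum_indicators (c0 := 1) hvL LP).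
    - by rewrite scale1r.
    - exact: toric_latticeC.
    - by move=> p Up; rewrite (mobius_sum_at hH) asboolF.
  by move=> p Up; rewrite (mobius_sum_at hH) asboolT.
move=> C CP; rewrite -scalerDr [in LHS](valuation_split hvL (LP _ CP) LH).
by rewrite ![_ `&` C]setIC.
Qed.
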